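(* Let $K$ be a field and $n\ge 1$ an integer. Let $A_n$ be the quiver with vertices $1,\dots,n$ and exactly one arrow $\alpha_i: i\to i+1$ for each $1\le i\le n-1$. Then the torsion classes in the category $\operatorname{rep} A_n$ of finite-dimensional representations of $A_n$ over $K$, ordered by inclusion, form a poset isomorphic to the Tamari lattice $T_n$.
   Context: A representation $V$ of a quiver $Q$ over $K$ assigns a finite-dimensional $K$-vector space $V_i$ to each vertex $i$ and a linear map $V_\alpha:V_i\to V_j$ to each arrow $\alpha:i\to j$. A morphism $f:V\to W$ is a family of linear maps $f_i:V_i\to W_i$ with $W_\alpha\circ f_i=f_j\circ V_\alpha$ for every arrow $\alpha:i\to j$; it is injective (surjective) if every $f_i$ is. Direct sums are formed vertexwise. A nonzero representation is indecomposable if it is not isomorphic to a direct sum of two nonzero representations. A representation $Y$ is an extension of $Z$ by $X$ if $Y$ has a subrepresentation isomorphic to $X$ such that the corresponding quotient representation is isomorphic to $Z$. ''Subcategory'' of $\operatorname{rep} Q$ always means full additive subcategory: a full subcategory for which there is a set of indecomposable representations such that the objects of the subcategory are exactly the representations isomorphic to finite direct sums (including the empty sum $0$) of indecomposables from this set. A torsion class $\mathcal B$ in $\operatorname{rep} Q$ is a full additive subcategory closed under quotients (if $Y\in\mathcal B$ and there is a surjection $Y\to Z$, then $Z\in\mathcal B$) and under extensions (if $X,Z\in\mathcal B$ and $Y$ is an extension of $Z$ by $X$, then $Y\in\mathcal B$). The Tamari lattice $T_n$ is the poset on the set of complete binary parenthesizations of a word of $n+2$ letters (so it has $\frac{1}{n+2}\binom{2n+2}{n+1}$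 elements), with order the reflexive-transitive closure of the relation in which one parenthesization is below another if the second is obtained from the first by replacing one occurrence of a sub-bracketing $((A B) C)$ by $(A(BC))$. *)

(* Defs.v *)
From HB Require Import structures.
From Stdlib Require Export Relation_Operators.
From mathcomp Require Export all_boot all_order all_algebra.
From mathcomp Require Export ring_quotient.

Set Implicit Arguments.
Unset Strict Implicit.
Unset Printing Implicit Defensive.

Import GRing.Theory.
Local Open Scope ring_scope.
Local Open Scope quotient_scope.

(* The quotient of a finite-dimensional vector space by a subspace: MathComp
   only has the quotient group [Quotient.quot], which we turn into a vectType. *)
Section QuotientSpace.
Variables (K : fieldType) (vT : vectType K) (U : {vspace vT}).

Definition vquot : Type := Quotient.quot (pred_of_vspace U).

HB.instance Definition _ := GRing.Zmodule.on vquot.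

Definition vquot_pi (x : vT) : vquot :=
  \pi_(Quotient.quot (pred_of_vspace U)) x.
Definition vquot_repr (q : vquot) : vT :=
  repr (q : Quotient.quot (pred_of_vspace U)).

Lemma vquot_piK (q : vquot) : vquot_pi (vquot_repr q) = q.
Proof. exact: reprK. Qed.

Lemma eq_vquot_pi (x y : vT) : (vquot_pi x == vquot_pi y) = (x - y \in U).
Proof. by rewrite -[RHS]/(pred_of_vspace U (x - y)) -[RHS]/(_ \in pred_of_vspace U) Quotient.idealrBE. Qed.

Lemma vquot_piD (x y : vT) : vquot_pi (x + y) = vquot_pi x + vquot_pi y.
Proof. exact: (@Quotient.pi_add _ (pred_of_vspace U) x y). Qed.

Definition vquot_scale (a : K) (q : vquot) : vquot :=
  vquot_pi (a *: vquot_repr q).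

Lemma vquot_pi_scale (a : K) (x : vT) :
  vquot_pi (a *: x) = vquot_scale a (vquot_pi x).
Proof.
apply/eqP; rewrite eq_vquot_pi -scalerBr; apply: rpredZ.
by rewrite -eq_vquot_pi vquot_piK.
Qed.

Fact vquot_scaleA a b q :
  vquot_scale a (vquot_scale b q) = vquot_scale (a * b) q.
Proof. by rewrite -[q]vquot_piK -!vquot_pi_scale scalerA. Qed.

Fact vquot_scale1 : left_id 1 vquot_scale.
Proof. by move=> q; rewrite -[q]vquot_piK -vquot_pi_scale scale1r. Qed.

Fact vquot_scaleDr : right_distributive vquot_scale +%R.
Proof.
move=> a p q; rewrite -[p]vquot_piK -[q]vquot_piK.
by rewrite -vquot_piD -!vquot_pi_scale scalerDr vquot_piD.
Qed.

Fact vquot_scaleDl q : {morph vquot_scale^~ q : a b / a + b}.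
Proof.
move=> a b; rewrite -[q]vquot_piK -!vquot_pi_scale.
by rewrite scalerDl vquot_piD.
Qed.

HB.instance Definition _ := GRing.Zmodule_isLmodule.Build K vquot
  vquot_scaleA vquot_scale1 vquot_scaleDr vquot_scaleDl.

Fact vquot_pi_is_linear : linear vquot_pi.
Proof. by move=> a x y; rewrite vquot_piD vquot_pi_scale. Qed.

HB.instance Definition _ :=
  GRing.isLinear.Build K vT vquot _ vquot_pi vquot_pi_is_linear.

Fact vquot_vect_iso : Vector.axiom (\dim (U^C)%VS) vquot.
Proof.
pose p := daddv_pi (U^C)%VS U.
pose f (q : vquot) : subvs_of (U^C)%VS := vsproj (U^C)%VS (p (vquot_repr q)).
have capUC : (U^C :&: U)%VS = 0%VS by rewrite capvC capv_compl.
have fE x : f (vquot_pi x) = vsproj (U^C)%VS (p x).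
  rewrite /f; congr (vsproj _ _); apply/eqP; rewrite -subr_eq0 -raddfB /=.
  have : vquot_repr (vquot_pi x) - x \in U by rewrite -eq_vquot_pi vquot_piK.
  move: (_ - x) => u uU; have := daddv_pi_add capUC (_ : u \in U^C + U)%VS.
  rewrite (daddv_pi_id _ uU) ?[(U :&: _)%VS]capvC //.
  move/(_ (subvP (addvSr _ _) u uU)) => /eqP.
  by rewrite -subr_eq0 addrK.
have fl : linear f.
  move=> a q r; rewrite -[q]vquot_piK -[r]vquot_piK.
  by rewrite -linearP !fE !linearP.
pose g (s : subvs_of (U^C)%VS) : vquot := vquot_pi (vsval s).
have gf : cancel f g.
  move=> q; rewrite -[q]vquot_piK fE /g vsprojK ?memv_pi //.
  apply/eqP; rewrite eq_vquot_pi -memvN opprB.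
  move: (vquot_repr q) => x.
  have xUC : x \in (U^C + U)%VS by rewrite addvC addv_complf memvf.
  by rewrite -{1}(daddv_pi_add capUC xUC) addrAC subrr add0r memv_pi.
have fg : cancel g f.
  by move=> s; rewrite /g fE /p (daddv_pi_id capUC) ?vsvalK ?subvsP //; exact: vsvalK.
have [h hl hb] := subvs_vect_iso (U^C)%VS.
exists (h \o f); first by move=> a x y; rewrite /= fl hl.
by apply: bij_comp => //; exists g.
Qed.

HB.instance Definition _ :=
  Lmodule_hasFinDim.Build K vquot vquot_vect_iso.

End QuotientSpace.

Record quiver := Quiver {
  vertex : finType;
  arrow : finType;
  source : arrow -> vertex;
  target : arrow -> vertex
}.

(* Vertices are numbered from 0; there is one arrow for each pair (i, i+1). *)
Definition quiverA (n : nat) : quiver :=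
  @Quiver 'I_n {p : 'I_n * 'I_n | p.2 == p.1.+1 :> nat}
    (fun a => (val a).1) (fun a => (val a).2).

Section Representations.
Variables (K : fieldType) (Q : quiver).

Record rep := Rep {
  rep_space :> vertex Q -> vectType K;
  rep_map : forall a : arrow Q, 'Hom(rep_space (source a), rep_space (target a))
}.

Record rep_hom (V W : rep) := RepHom {
  rep_hom_fun :> forall i, 'Hom(V i, W i);
  rep_homP : forall (a : arrow Q) (x : V (source a)),
    rep_map W a (rep_hom_fun (source a) x) =
    rep_hom_fun (target a) (rep_map V a x)
}.

Definition rep_surjective (V W : rep) (f : rep_hom V W) : Prop :=
  forall i (y : W i), exists x, f i x = y.

Definition rep_iso (V W : rep) : Prop :=
  exists (f : rep_hom V W) (g : rep_hom W V),
    forall i, cancel (f i) (g i) /\ cancel (g i) (f i).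

Definition rep0 : rep := @Rep (fun=> 'rV[K]_0) (fun=> 0).

Definition rep_nonzero (V : rep) : Prop := exists i, exists x : V i, x != 0.

Section DirectSum.
Variables V W : rep.

Definition dsum_fun (a : arrow Q) (x : V (source a) * W (source a)) :
  V (target a) * W (target a) := (rep_map V a x.1, rep_map W a x.2).

Fact dsum_fun_is_linear a : linear (@dsum_fun a).
Proof. by move=> k x y; rewrite /dsum_fun !linearP. Qed.

HB.instance Definition _ a :=
  GRing.isLinear.Build K _ _ _ (@dsum_fun a) (@dsum_fun_is_linear a).

Definition dsum : rep :=
  @Rep (fun i => (V i * W i)%type) (fun a => linfun (@dsum_fun a)).

End DirectSum.

Definition indecomposable (V : rep) : Prop :=
  rep_nonzero V /\
  ~ exists V1 V2, rep_nonzero V1 /\ rep_nonzero V2 /\ rep_iso V (dsum V1 V2).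

Record subrep (V : rep) := Subrep {
  subrep_space :> forall i, {vspace V i};
  subrepP : forall (a : arrow Q) (x : V (source a)),
    x \in subrep_space (source a) -> rep_map V a x \in subrep_space (target a)
}.

Section SubQuotient.
Variables (V : rep) (U : subrep V).

Definition rep_of_subrep : rep :=
  @Rep (fun i => subvs_of (U i))
    (fun a => linfun (vsproj (U (target a)) \o rep_map V a \o vsval)).

Lemma rep_of_subrepE (a : arrow Q) (x : subvs_of (U (source a))) :
  vsval (rep_map rep_of_subrep a x) = rep_map V a (vsval x).
Proof. by rewrite lfunE /= vsprojK // subrepP ?subvsP. Qed.

Definition quot_fun (a : arrow Q) (q : vquot (U (source a))) :
  vquot (U (target a)) := vquot_pi _ (rep_map V a (vquot_repr q)).

Lemma quot_funE (a : arrow Q) (x : V (source a)) :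
  quot_fun (vquot_pi (U (source a)) x) = vquot_pi _ (rep_map V a x).
Proof.
apply/eqP; rewrite eq_vquot_pi -linearB; apply: subrepP.
by rewrite -eq_vquot_pi vquot_piK.
Qed.

Fact quot_fun_is_linear a : linear (@quot_fun a).
Proof.
move=> k q r; rewrite -[q]vquot_piK -[r]vquot_piK.
by rewrite -linearP !quot_funE !linearP.
Qed.

HB.instance Definition _ a :=
  GRing.isLinear.Build K _ _ _ (@quot_fun a) (@quot_fun_is_linear a).

Definition quot_rep : rep :=
  @Rep (fun i => vquot (U i)) (fun a => linfun (@quot_fun a)).

End SubQuotient.

(* Y is an extension of Z by X. *)
Definition extension (Y Z X : rep) : Prop :=
  exists U : subrep Y, rep_iso (rep_of_subrep U) X /\ rep_iso (quot_rep U) Z.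

(* Full subcategories are given by their classes of objects: plain predicates,
   since [set rep] of MathComp-Analysis raises a universe inconsistency. *)
Definition additive_subcat (B : rep -> Prop) : Prop :=
  exists2 S : rep -> Prop, (forall V, S V -> indecomposable V) &
    forall V, B V <->
      exists (k : nat) (F : 'I_k -> rep),
        (forall j, S (F j)) /\ rep_iso V (\big[dsum/rep0]_(j < k) F j).

Definition closed_under_quotients (B : rep -> Prop) : Prop :=
  forall (Y Z : rep) (f : rep_hom Y Z), B Y -> rep_surjective f -> B Z.

Definition closed_under_extensions (B : rep -> Prop) : Prop :=
  forall X Y Z : rep, B X -> B Z -> extension Y Z X -> B Y.

Definition is_torsion_class (B : rep -> Prop) : Prop :=
  [/\ additive_subcat B, closed_under_quotients B & closed_under_extensions B].

Definition torsion_class : Type := {B : rep -> Prop | is_torsion_class B}.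

Definition torsion_le (B C : torsion_class) : Prop :=
  forall V, proj1_sig B V -> proj1_sig C V.

End Representations.

Inductive paren : Type := Letter | Bracket of paren & paren.

Fixpoint letters (t : paren) : nat :=
  if t is Bracket l r then (letters l + letters r)%N else 1%N.

(* One replacement of a sub-bracketing ((A B) C) by (A (B C)). *)
Inductive reassoc : paren -> paren -> Prop :=
| reassoc_here A B C :
    reassoc (Bracket (Bracket A B) C) (Bracket A (Bracket B C))
| reassoc_left A A' B : reassoc A A' -> reassoc (Bracket A B) (Bracket A' B)
| reassoc_right A B B' : reassoc B B' -> reassoc (Bracket A B) (Bracket A B').

Definition tamari (n : nat) : Type := {t : paren | letters t == n.+2}.

Definition tamari_le (n : nat) : tamari n -> tamari n -> Prop :=
  clos_refl_trans (tamari n) (fun s t => reassoc (proj1_sig s) (proj1_sig t)).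

Definition poset_isomorphic (S T : Type)
    (leS : S -> S -> Prop) (leT : T -> T -> Prop) : Prop :=
  exists2 f : S -> T, bijective f & forall x y, leS x y <-> leT (f x) (f y).

(* Main.v *)
Require Import Defs.
From HB Require Import structures.
From Stdlib Require Import Operators_Properties ClassicalEpsilon.
From Stdlib Require Import FunctionalExtensionality PropExtensionality.
From Stdlib Require Import ProofIrrelevance.
From mathcomp Require Import zify.

Set Implicit Arguments.
Unset Strict Implicit.
Unset Printing Implicit Defensive.

Import GRing.Theory.

(** Both posets are identified with the same set of integer vectors.  Write
    M[a,b] for the indecomposable that is K at the vertices a, ..., b and 0
    elsewhere (vertices 0, ..., n-1).  Its quotients are the M[a,b'] with
    b' <= b, and M[a,c] is an extension of M[a,b] by M[b+1,c].  Hence the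
    intervals lying in a torsion class B are described by the numbers
    w_a = #{b | M[a,b] in B}, where b ranges over a, a+1, ...; closure under
    these extensions says that
      i < j <= i + w_i   implies   j + w_j <= i + w_i,
    and i + w_i never exceeds n.  Such vectors, with a final entry w_n = 0, are
    the bracket vectors of the complete binary trees with n + 1 inner nodes:
    w_i is the number of inner nodes in the right subtree of the i-th node in
    the in-order traversal.

    On the tree side, a reassociation ((A B) C) -> (A (B C)) raises exactly one
    entry of the vector.  Conversely, if a bracket vector w lies strictly above
    that of a tree, some reassociation of the tree stays below w
    ([reassoc_step]).  So the Tamari order is the pointwise order
    ([reassoc_starP], [tamari_leP]), and starting from the left comb, whose
    vector is 0, every bracket vector is reached ([bvec_onto]).

    On the side of representations, a torsion class B is recovered from its
    intervals without decomposing its objects into intervals.  Call M[c,d]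
    forbidden if no M[e,d] with c <= e <= d lies in B.  These are the intervals
    to which no object of B has a nonzero map, because the image of a nonzero
    map to M[c,d] is a subrepresentation M[e,d], a quotient of the source
    ([hom_to_interval_image]).  Conversely a representation V without nonzero
    maps to forbidden intervals lies in B ([torsion_of_torsion]), by induction on
    the dimension.  If V is not 0, take d to be the last vertex with V_d <> 0 and c the first one such that V_c -> V_d is onto.
    A functional on V_d that kills the image of V_(c-1) defines a nonzero map
    V -> M[c,d], so M[c,d] is not forbidden and some M[e,d] with c <= e <= d is
    in B.  As V_e maps onto V_d, it contains a vector x <> 0; it defines a
    nonzero map M[e,d] -> V, since nothing in V survives beyond d.  Its image is
    in B, the quotient of V by this image is in B by induction, and V is an
    extension of the two.

    In the other direction, the class of all V with Hom(V, M) = 0 for every M in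
    a given family is always a torsion class ([left_perp_torsion]), and for the
    family forbidden by a bracket vector the intervals in this class are the
    prescribed ones ([torsion_of_interval]).  *)

(** * Bracket vectors of binary trees *)

(** In-order list of the sizes of the right subtrees. *)
Fixpoint bvec (t : paren) : seq nat :=
  if t is Bracket l r then bvec l ++ size (bvec r) :: bvec r else [::].

(** With h(i) = i + w_i, the last index in the right subtree of node i, this says
    that h(i) is an index and that the index ranges [i, h(i)] are nested or
    disjoint. *)
Definition bracket_vector (w : seq nat) : Prop :=
  forall i, i < size w -> i + nth 0 w i < size w /\
    forall j, i < j -> j <= i + nth 0 w i -> j + nth 0 w j <= i + nth 0 w i.

Definition vle (v w : seq nat) : Prop := forall i, nth 0 v i <= nth 0 w i.

Lemma size_bvec t : letters t = (size (bvec t)).+1.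
Proof. by elim: t => //= l -> r ->; rewrite size_cat /=; lia. Qed.

Lemma nth_bvec l r i :
  nth 0 (bvec (Bracket l r)) i =
  if i < size (bvec l) then nth 0 (bvec l) i
  else if i == size (bvec l) then size (bvec r)
  else nth 0 (bvec r) (i - (size (bvec l)).+1).
Proof.
rewrite /= nth_cat; case: ltnP => // le.
case: eqVneq => [->|ne]; first by rewrite subnn.
by have -> : i - size (bvec l) = (i - (size (bvec l)).+1).+1 by lia.
Qed.

Lemma bvec_bracket_vector t : bracket_vector (bvec t).
Proof.
elim: t => [|l IHl r IHr] // i.
rewrite /= size_cat /= -/(bvec (Bracket l r)) => lti.
rewrite !nth_bvec; case: (ltnP i (size (bvec l))) => [il|li].
  have [h1 h2] := IHl i il; split; first by lia.
  move=> j ij jle; rewrite nth_bvec.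
  case: (ltnP j (size (bvec l))) => [jl|lj]; last by lia.
  exact: h2.
case: (eqVneq i (size (bvec l))) => [->|ne].
  split; first by lia.
  move=> j ij jle; rewrite nth_bvec.
  case: (ltnP j (size (bvec l))) => [jl|lj]; first by lia.
  case: (eqVneq j (size (bvec l))) => [ej|nj]; first by lia.
  have [//|h1 _] := IHr (j - (size (bvec l)).+1); lia.
have [|h1 h2] := IHr (i - (size (bvec l)).+1); first by lia.
split; first by lia.
move=> j ij jle; rewrite nth_bvec.
case: (ltnP j (size (bvec l))) => [jl|lj]; first by lia.
case: (eqVneq j (size (bvec l))) => [ej|nj]; first by lia.
have := h2 (j - (size (bvec l)).+1); lia.
Qed.

(** The root is the first index i with h(i) maximal: the right subtree of a node
    left of the root ends before the root.  So the vector determines the sizes of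
    both subtrees of the root, hence both subtrees. *)
Lemma bvec_inj : injective bvec.
Proof.
have root_le l r l' r' : bvec (Bracket l r) = bvec (Bracket l' r') ->
    size (bvec l') <= size (bvec l).
  move=> e; rewrite leqNgt; apply/negP => lt.
  have es := congr1 size e; have en := congr1 (nth 0 ^~ (size (bvec l))) e.
  move: en es; rewrite /= !nth_bvec ltnn eqxx lt !size_cat /= => en es.
  have [h _] := bvec_bracket_vector lt; lia.
elim=> [|l IHl r IHr] [|l' r'] // e.
- by move: e => /=; case: (bvec l').
- by move: e => /=; case: (bvec l).
have es : size (bvec l) = size (bvec l').
  by apply/eqP; rewrite eqn_leq (root_le _ _ _ _ e) (root_le _ _ _ _ (esym e)).
move/eqP: e => /=; rewrite eqseq_cat // eqseq_cons => /and3P[/eqP el _ /eqP er].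
by rewrite (IHl _ el) (IHr _ er).
Qed.

Lemma reassoc_size s t : reassoc s t -> size (bvec s) = size (bvec t).
Proof.
elim=> [A B C|A A' B _ IH|A B B' _ IH] /=;
  rewrite !size_cat /= ?size_cat ?IH //=; lia.
Qed.


Lemma nth_rotate A B C i :
  nth 0 (bvec (Bracket A (Bracket B C))) i =
  if i == size (bvec A) then (size (bvec B) + (size (bvec C)).+1)%N
  else nth 0 (bvec (Bracket (Bracket A B) C)) i.
Proof.
rewrite /= -catA /= !nth_cat size_cat /=; case: ltnP => [lt|le].
  by case: eqVneq lt => // ->; rewrite ltnn.
case: eqVneq => [->|ne]; first by rewrite subnn.
by have -> : i - size (bvec A) = (i - (size (bvec A)).+1).+1 by lia.
Qed.

Lemma reassoc_vle s t : reassoc s t -> vle (bvec s) (bvec t).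
Proof.
elim=> [A B C|A A' B r IH|A B B' r IH] i.
- rewrite nth_rotate; case: eqVneq => // ->.
  rewrite !nth_bvec ltnn eqxx ifT ?leq_addr //.
  by rewrite size_cat /= -addSnnS leq_addr.
- rewrite !nth_bvec (reassoc_size r); case: ltnP => // _; exact: IH.
- rewrite !nth_bvec (reassoc_size r); do 2 case: ifP => // _; exact: IH.
Qed.

Lemma bracket_vector_drop k w :
  bracket_vector w -> bracket_vector (drop k w).
Proof.
move=> vw i; rewrite size_drop nth_drop => lti.
have [|h1 h2] := vw (k + i); first by lia.
split=> [|j ij jle]; first by lia.
by rewrite nth_drop; have := h2 (k + j); lia.
Qed.

Definition truncate k (w : seq nat) : seq nat :=
  mkseq (fun i => minn (nth 0 w i) (k - i.+1)) k.

Lemma nth_truncate k w i :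
  nth 0 (truncate k w) i = if i < k then minn (nth 0 w i) (k - i.+1) else 0.
Proof.
case: ltnP => lt; first by rewrite nth_mkseq.
by rewrite nth_default // size_mkseq.
Qed.

(** Truncation replaces h(i) by the minimum of h(i) and k - 1. *)
Lemma bracket_vector_truncate k w :
  k <= size w -> bracket_vector w -> bracket_vector (truncate k w).
Proof.
move=> kw vw i; rewrite size_mkseq => lti.
rewrite nth_truncate lti; split=> [|j ij jle]; first by lia.
rewrite nth_truncate; case: ltnP => ltj; last by lia.
by have [|_ /(_ j)] := vw i; lia.
Qed.

(** Let k be the index of the root of [t = Bracket l r].  First use the left
    subtree [l] against the truncation of w to its k indices.  If nothing is
    gained there although w leaves the range of [l] at some index i, then i is on
    the right spine of [l]; nestedness forces w to leave this range at the root of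
    [l] too, and to contain there all of [r], so that the reassociation at the
    root of [t] is allowed.  Otherwise w agrees with the vector of [t] up to the
    index k, and one continues in [r]. *)
Lemma reassoc_step t w :
  bracket_vector w -> size w = size (bvec t) -> vle (bvec t) w ->
  bvec t = w \/ exists2 t', reassoc t t' & vle (bvec t') w.
Proof.
elim: t w => [|l IHl r IHr] w vw sw lew; first by left; case: w sw {vw lew}.
set k := size (bvec l); set n := size (bvec r).
have {}sw : size w = k + n.+1 by rewrite sw /= size_cat.
have wk : nth 0 w k = n.
  have [] := vw k; first by rewrite sw; lia.
  by have := lew k; rewrite nth_bvec ltnn eqxx -/n => *; lia.
have lewl : vle (bvec l) (truncate k w).
  move=> i; rewrite nth_truncate; case: ltnP => lt; last by rewrite nth_default.
  have [+ _] := bvec_bracket_vector lt.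
  by have := lew i; rewrite nth_bvec lt -/k; lia.
have vwl : bracket_vector (truncate k w).
  by apply: bracket_vector_truncate => //; rewrite sw leq_addr.
have [el|[l1 rl le1]] := IHl _ vwl (size_mkseq _ _) lewl; last first.
  right; exists (Bracket l1 r); first exact: reassoc_left.
  move=> i; rewrite nth_bvec -(reassoc_size rl); case: ltnP => lt.
    by apply: leq_trans (le1 i) _; rewrite nth_truncate lt geq_minl.
  by apply: leq_trans (lew i); rewrite nth_bvec ltnNge lt.
have nl i : i < k -> nth 0 (bvec l) i = minn (nth 0 w i) (k - i.+1).
  by move=> lt; rewrite el nth_truncate lt.
pose same_at i := nth 0 w i == nth 0 (bvec l) i.
have [/allP same|/allPn[i]] := boolP (all same_at (iota 0 k)).
  have {}same i : i < k -> nth 0 w i = nth 0 (bvec l) i.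
    by move=> lt; apply/eqP/same; rewrite mem_iota.
  have sd : size (drop k.+1 w) = n by rewrite size_drop sw; lia.
  have ew : w = bvec l ++ n :: drop k.+1 w.
    rewrite -{1}(cat_take_drop k w) (drop_nth 0) ?wk ?sw; last by lia.
    congr (_ ++ _); apply: (@eq_from_nth _ 0) => [|i].
      by rewrite size_take sw; case: ltnP => //; lia.
    rewrite size_take sw ifT; last by lia.
    by move=> lt; rewrite nth_take ?same.
  have led : vle (bvec r) (drop k.+1 w).
    move=> i; rewrite nth_drop; have := lew (k.+1 + i); rewrite nth_bvec -/k.
    rewrite ltnNge (_ : k <= _); last by lia.
    rewrite (_ : _ == k = false); last by lia.
    by rewrite addKn.
  have vd := bracket_vector_drop (k := k.+1) vw.
  have [er|[r1 rr le1]] := IHr _ vd sd led; first by left; rewrite ew -er.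
  right; exists (Bracket l r1); first exact: reassoc_right.
  move=> i; rewrite nth_bvec -/k -(reassoc_size rr); case: ltnP => lt.
    by rewrite same.
  case: eqVneq => [->|ne]; first by rewrite wk.
  have -> : i = k.+1 + (i - k.+1) by lia.
  by rewrite addKn -nth_drop le1.
rewrite mem_iota /= add0n /same_at => ltik; rewrite nl // => big.
have {}big : k <= i + nth 0 w i by lia.
have : k = size (bvec l) by [].
clearbody k; case: l nl lew {IHl el lewl vwl same_at} => [|a b] nl lew ek.
  by rewrite ek in ltik.
right; exists (Bracket a (Bracket b r)); first exact: reassoc_here.
move=> j; rewrite nth_rotate; case: eqVneq => // ->.
set ra := size (bvec a); have {}ek : k = ra + (size (bvec b)).+1.
  by rewrite ek /= size_cat.
have lta : ra < k by rewrite ek -addSnnS leq_addr.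
have wa : size (bvec b) = minn (nth 0 w ra) (k - ra.+1).
  by rewrite -nl // nth_bvec ltnn eqxx.
suff out : k <= ra + nth 0 w ra.
  have [|_ /(_ k)] := vw ra; first by lia.
  by rewrite wk -/n; lia.
case: (ltngtP ra i) => [lt|gt|e]; last by rewrite e.
- by have [|_ /(_ i)] := vw ra; lia.
(* a node before the root of [l] cannot reach the end of [l] *)
exfalso; have := nl i ltik; rewrite nth_bvec gt.
by have [] := bvec_bracket_vector gt; rewrite -/ra; lia.
Qed.

Definition reassoc_star := clos_refl_trans paren reassoc.


Lemma reassoc_star_vle s t : reassoc_star s t -> vle (bvec s) (bvec t).
Proof.
elim=> [x y|x i|x y z _ xy _ yz i]; [exact: reassoc_vle|exact: leqnn|].
exact: leq_trans (xy i) (yz i).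
Qed.

Lemma reassoc_sumn s t : reassoc s t -> sumn (bvec s) < sumn (bvec t).
Proof.
elim=> [A B C|A A' B r IH|A B B' r IH] /=;
  rewrite ?(size_cat, sumn_cat) /= ?(size_cat, sumn_cat) ?(reassoc_size r) /=;
  lia.
Qed.

Lemma vle_sumn v w : size v = size w -> vle v w -> sumn v <= sumn w.
Proof.
elim: v w => [|a v IH] [|b w] // [/IH {}IH] le /=.
by rewrite leq_add //; [exact: (le 0)|apply: IH => i; exact: (le i.+1)].
Qed.

(** Each step raises the sum of the entries, which stays at most that of w. *)
Lemma reassoc_star_onto t w :
  bracket_vector w -> size w = size (bvec t) -> vle (bvec t) w ->
  exists2 t', reassoc_star t t' & bvec t' = w.
Proof.
move=> vw; have [m] := ubnP (sumn w - sumn (bvec t)).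
elim: m t => // m IHm t ltm sw lew.
have [e|[t1 r le1]] := reassoc_step vw sw lew.
  by exists t => //; exact: rt_refl.
have sw1 : size w = size (bvec t1) by rewrite sw (reassoc_size r).
have [|t2 r2 e2] := IHm t1 _ sw1 le1; last first.
  by exists t2 => //; apply: rt_trans r2; exact: rt_step.
have := reassoc_sumn r; have := vle_sumn (esym sw1) le1; lia.
Qed.

Lemma reassoc_starP s t : size (bvec s) = size (bvec t) ->
  reassoc_star s t <-> vle (bvec s) (bvec t).
Proof.
move=> est; split; first exact: reassoc_star_vle.
case/(reassoc_star_onto (@bvec_bracket_vector t) (esym est)) => t' r e.
by rewrite -(bvec_inj e).
Qed.

(** The left comb has the zero vector, so it lies below every w. *)
Lemma bvec_onto w : bracket_vector w -> exists t, bvec t = w.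
Proof.
pose comb m := iter m (Bracket^~ Letter) Letter.
have bcomb m : bvec (comb m) = nseq m 0.
  by elim: m => //= m ->; rewrite -[RHS]/(nseq m.+1 0) -addn1 nseqD.
move=> vw; have [||t _ <-] := @reassoc_star_onto (comb (size w)) w vw.
- by rewrite bcomb size_nseq.
- by move=> i; rewrite bcomb nth_nseq if_same.
- by exists t.
Qed.

Lemma tamari_leP n (s t : tamari n) :
  tamari_le s t <-> vle (bvec (val s)) (bvec (val t)).
Proof.
have sz (u : tamari n) : size (bvec (val u)) = n.+1.
  by have /eqP := valP u; rewrite size_bvec => -[].
rewrite -reassoc_starP ?sz //; split.
  elim=> [x y r|x|x y z _ xy _ yz]; [exact: rt_step|exact: rt_refl|].
  exact: rt_trans xy yz.
case: s t => [s hs] [t ht] /= /(clos_rt_rt1n _ _ _ _) r.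
elim: r hs ht => [x|x y z xy _ IH] hx hz.
  by rewrite (bool_irrelevance hx hz); exact: rt_refl.
have hy : letters y == n.+2 by rewrite size_bvec -(reassoc_size xy) -size_bvec.
by apply: rt_trans (IH hy hz); exact: rt_step.
Qed.

(** * Morphisms and direct sums of representations *)

Section Homs.
Local Open Scope ring_scope.
Variables (K : fieldType) (Q : quiver).
Implicit Types V W X Y Z T : rep K Q.

Section MkHom.
Variables (V W : rep K Q) (f : forall i, V i -> W i).
Hypothesis lf : forall i, linear (@f i).
Hypothesis cf : forall a x, rep_map W a (f x) = f (rep_map V a x).

Let hom_lin i : {linear V i -> W i} :=
  HB.pack_for {linear V i -> W i} (@f i)
    (GRing.isLinear.Build K (V i) (W i) _ (@f i) (@lf i)).

Lemma rep_hom_ex : exists h : rep_hom V W, forall i x, h i x = f x.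
Proof.
have E i x : linfun (hom_lin i) x = f x by rewrite lfunE.
have C a x : rep_map W a (linfun (hom_lin (source a)) x) =
    linfun (hom_lin (target a)) (rep_map V a x) by rewrite !E cf.
by exists (@RepHom K Q V W (fun i => linfun (hom_lin i)) C).
Qed.
End MkHom.

Lemma rep_hom_comp V W X (f : rep_hom V W) (g : rep_hom W X) :
  exists h : rep_hom V X, forall i x, h i x = g i (f i x).
Proof.
apply: (@rep_hom_ex V X (fun i x => g i (f i x))) => [i k x y|a x].
  by rewrite !linearP.
by rewrite !rep_homP.
Qed.

Lemma rep_iso_refl V : rep_iso V V.
Proof.
have [//|//|h hE] := @rep_hom_ex V V (fun i x => x).
by exists h, h => i; split=> x; rewrite !hE.
Qed.

Lemma rep_iso_sym V W : rep_iso V W -> rep_iso W V.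
Proof. by case=> f [g fg]; exists g, f => i; have [] := fg i; split. Qed.

Lemma rep_iso_trans V W X : rep_iso V W -> rep_iso W X -> rep_iso V X.
Proof.
case=> f [f' ff'] [g [g' gg']].
have [h hE] := rep_hom_comp f g; have [h' hE'] := rep_hom_comp g' f'.
exists h, h' => i; have [fK fK'] := ff' i; have [gK gK'] := gg' i.
by split=> x; rewrite hE hE' ?gK ?fK ?fK' ?gK'.
Qed.

Lemma rep_iso_surj V W :
  rep_iso V W -> exists f : rep_hom V W, rep_surjective f.
Proof.
by case=> f [g fg]; exists f => i y; exists (g i y); have [_ ->] := fg i.
Qed.

Lemma bij_rep_iso V W (f : forall i, V i -> W i) (g : forall i, W i -> V i) :
  (forall i, linear (f i)) ->
  (forall a x, rep_map W a (f _ x) = f _ (rep_map V a x)) ->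
  (forall i, cancel (f i) (g i)) -> (forall i, cancel (g i) (f i)) ->
  rep_iso V W.
Proof.
move=> lf cf fK gK; have [h hE] := rep_hom_ex lf cf.
have [|a y|h' hE'] := @rep_hom_ex W V g.
- by move=> i k x y; rewrite -[RHS]fK lf !gK.
- by rewrite -[LHS]fK -cf !gK.
by exists h, h' => i; split=> x; rewrite hE hE' ?fK ?gK.
Qed.

Lemma rep_map_dsum V W a x :
  rep_map (dsum V W) a x = (rep_map V a x.1, rep_map W a x.2).
Proof. by rewrite lfunE. Qed.

Lemma dsum_iso V V' W W' : rep_iso V V' -> rep_iso W W' ->
  rep_iso (dsum V W) (dsum V' W').
Proof.
case=> f [f' ff'] [g [g' gg']].
apply: (@bij_rep_iso (dsum V W) (dsum V' W') (fun i x => (f i x.1, g i x.2))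
   (fun i x => (f' i x.1, g' i x.2))) => [i k x y|a x|i [x y]|i [x y]].
- by rewrite !linearP.
- by rewrite !rep_map_dsum /= !rep_homP.
- by have [fK _] := ff' i; have [gK _] := gg' i; rewrite /= fK gK.
- by have [_ fK] := ff' i; have [_ gK] := gg' i; rewrite /= fK gK.
Qed.

Lemma dsum_assoc V W X : rep_iso (dsum (dsum V W) X) (dsum V (dsum W X)).
Proof.
apply: (@bij_rep_iso (dsum (dsum V W) X) (dsum V (dsum W X))
  (fun i x => (x.1.1, (x.1.2, x.2))) (fun i x => ((x.1, x.2.1), x.2.2)))
  => [i k x y|a x|i [[x y] z]|i [x [y z]]] //.
by rewrite !rep_map_dsum.
Qed.

Lemma dsum_zerol V W : ~ rep_nonzero V -> rep_iso W (dsum V W).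
Proof.
move=> V0; have {}V0 i (x : V i) : x = 0.
  by apply/eqP/negPn/negP => nz; apply: V0; exists i, x.
apply: (@bij_rep_iso W (dsum V W) (fun i x => (0, x)) (fun i x => x.2))
  => [i k x y|a x|i x|i [x y]] //.
- by congr (_, _); rewrite /= scaler0 addr0.
- by rewrite rep_map_dsum linear0.
- by rewrite [x]V0.
Qed.

Lemma rep0_zero i (x : rep0 K Q i) : x = 0.
Proof. exact: thinmx0. Qed.

Lemma dsum_rep0 V : rep_iso V (dsum V (rep0 K Q)).
Proof.
apply: (@bij_rep_iso V (dsum V (rep0 K Q)) (fun i x => (x, 0)) (fun i x => x.1))
  => [i k x y|a x|i x|i [x y]] //.
- by congr (_, _); rewrite /= scaler0 addr0.
- by rewrite rep_map_dsum linear0.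
- by rewrite [y]rep0_zero.
Qed.

Lemma dsum_fst V W :
  exists f : rep_hom (dsum V W) V, forall i x, f i x = x.1.
Proof.
apply: (@rep_hom_ex (dsum V W) V (fun i x => x.1)) => // a x.
by rewrite rep_map_dsum.
Qed.

Lemma dsum_snd V W :
  exists f : rep_hom (dsum V W) W, forall i x, f i x = x.2.
Proof.
apply: (@rep_hom_ex (dsum V W) W (fun i x => x.2)) => // a x.
by rewrite rep_map_dsum.
Qed.

Lemma dsum_inl V W :
  exists f : rep_hom V (dsum V W), forall i x, f i x = (x, 0).
Proof.
apply: (@rep_hom_ex V (dsum V W) (fun i x => (x, 0))) => [i k x y|a x].
  by congr (_, _); rewrite /= scaler0 addr0.
by rewrite rep_map_dsum /= linear0.
Qed.

Lemma dsum_inr V W :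
  exists f : rep_hom W (dsum V W), forall i x, f i x = (0, x).
Proof.
apply: (@rep_hom_ex W (dsum V W) (fun i x => (0, x))) => [i k x y|a x].
  by congr (_, _); rewrite /= scaler0 addr0.
by rewrite rep_map_dsum /= linear0.
Qed.

Definition rep_dim V : nat := (\sum_i \dim {: V i})%N.

Lemma rep_dim_lt V W (f : rep_hom V W) i (x : V i) :
  rep_surjective f -> f i x = 0 -> x != 0 -> (rep_dim W < rep_dim V)%N.
Proof.
move=> fs fx nx.
have dimE j : \dim {: V j} = (\dim (lker (f j)) + \dim {: W j})%N.
  rewrite -(limg_ker_dim (f j) fullv) capfv; congr (_ + \dim _)%N.
  apply/eqP; rewrite eqEsubv subvf; apply/subvP => y _.
  by have [z <-] := fs j y; rewrite memv_img ?memvf.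
rewrite /rep_dim (bigD1 i) //= [X in (_ < X)%N](bigD1 i) //= -addSn leq_add //.
  rewrite dimE -add1n leq_add2r lt0n dimv_eq0; apply/eqP => k0.
  by move: nx; rewrite -memv0 -k0 memv_ker fx eqxx.
by apply: leq_sum => j _; rewrite dimE leq_addl.
Qed.

(** Existence of a decomposition by induction on the dimension.  An arbitrary
    already decomposed summand T is carried along: splitting V as V1 + V2 then
    amounts to adding V2 to T and V1 to the result, so that the list of summands
    grows by one indecomposable at a time. *)
Lemma krull_schmidt (B : rep K Q -> Prop) V :
  closed_under_quotients B -> B V ->
  exists k (F : 'I_k -> rep K Q), (forall j, indecomposable (F j) /\ B (F j)) /\
    rep_iso V (\big[@dsum K Q/rep0 K Q]_(j < k) F j).
Proof.
move=> qB; pose D T := exists k (F : 'I_k -> rep K Q),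
  (forall j, indecomposable (F j) /\ B (F j)) /\
    rep_iso T (\big[@dsum K Q/rep0 K Q]_(j < k) F j).
have Diso T T' : rep_iso T T' -> D T' -> D T.
  by move=> TT' [k [F [HF H]]]; exists k, F; split=> //; exact: rep_iso_trans H.
suff main T : B V -> D T -> D (dsum V T).
  move=> BV; apply: Diso (dsum_rep0 V) _; apply: main => //.
  exists 0%N, (fun=> rep0 K Q); split=> [[]//|].
  by rewrite big_ord0; exact: rep_iso_refl.
have [m] := ubnP (rep_dim V); elim: m V T => // m IHm V T ltm BV DT.
have [nzV|zV] := classic (rep_nonzero V); last first.
  by apply: Diso DT; apply: rep_iso_sym; exact: dsum_zerol.
have [iV|dV] := classic (indecomposable V).
  case: DT => k [F [HF H]].
  exists k.+1, (fun j => if unlift ord0 j is Some j' then F j' else V).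
  split=> [j|]; first by case: unliftP.
  rewrite big_ord_recl unlift_none; apply: dsum_iso; first exact: rep_iso_refl.
  by under eq_bigr do rewrite liftK.
have [V1 [V2 [nz1 [nz2 VV]]]] : exists V1 V2,
    rep_nonzero V1 /\ rep_nonzero V2 /\ rep_iso V (dsum V1 V2).
  by apply: NNPP => h; apply: dV; split.
have [f [g fg]] := VV.
have [p1 p1E] := dsum_fst V1 V2; have [p2 p2E] := dsum_snd V1 V2.
have [h1 h1E] := rep_hom_comp f p1; have [h2 h2E] := rep_hom_comp f p2.
have s1 : rep_surjective h1.
  by move=> i y; exists (g i (y, 0)); have [_ gK] := fg i; rewrite h1E p1E gK.
have s2 : rep_surjective h2.
  by move=> i y; exists (g i (0, y)); have [_ gK] := fg i; rewrite h2E p2E gK.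
have lt1 : (rep_dim V1 < rep_dim V)%N.
  case: nz2 => i [y ny]; have [_ gK] := fg i.
  apply: (@rep_dim_lt _ _ h1 i (g i (0, y))) => //; first by rewrite h1E p1E gK.
  apply: contra_neq ny => e; have := congr1 (f i) e.
  by rewrite gK linear0 => -[].
have lt2 : (rep_dim V2 < rep_dim V)%N.
  case: nz1 => i [y ny]; have [_ gK] := fg i.
  apply: (@rep_dim_lt _ _ h2 i (g i (y, 0))) => //; first by rewrite h2E p2E gK.
  apply: contra_neq ny => e; have := congr1 (f i) e.
  by rewrite gK linear0 => -[].
apply: (@Diso _ (dsum V1 (dsum V2 T))).
  apply: rep_iso_trans (dsum_assoc _ _ _); exact: dsum_iso (rep_iso_refl _).
apply: (IHm).
- exact: leq_trans lt1 ltm.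
- exact: qB BV s1.
apply: IHm => //; first exact: leq_trans lt2 ltm.
exact: qB BV s2.
Qed.

End Homs.

(** * Torsion classes of an arbitrary quiver *)

Section Torsion.
Local Open Scope ring_scope.
Variables (K : fieldType) (Q : quiver).
Implicit Types V W X Y Z M : rep K Q.

Lemma rep_map_quot Y (U : subrep Y) a x :
  rep_map (quot_rep U) a (vquot_pi (U (source a)) x) =
  vquot_pi (U (target a)) (rep_map Y a x).
Proof. by rewrite lfunE /= quot_funE. Qed.

Lemma quot_proj Y (U : subrep Y) :
  exists2 p : rep_hom Y (quot_rep U), rep_surjective p &
    forall i x, (p i x == 0) = (x \in U i).
Proof.
have [i k x y|a x|p pE] :=
  @rep_hom_ex _ _ Y (quot_rep U) (fun i x => vquot_pi (U i) x).
- by rewrite linearP.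
- by rewrite rep_map_quot.
exists p => [i y|i x]; first by exists (vquot_repr y); rewrite pE vquot_piK.
by rewrite pE -(linear0 (@vquot_pi _ _ (U i))) eq_vquot_pi subr0.
Qed.

Lemma subrep_incl Y (U : subrep Y) :
  exists f : rep_hom (rep_of_subrep U) Y, forall i x, f i x = vsval x.
Proof.
apply: (@rep_hom_ex _ _ (rep_of_subrep U) Y (fun i x => vsval x))
  => [i k x y|a x].
  by rewrite linearP.
by rewrite rep_of_subrepE.
Qed.

Definition left_perp (F : rep K Q -> Prop) V : Prop :=
  forall M, F M -> forall (f : rep_hom V M) i x, f i x = 0.

(** A map from an extension Y to M vanishes on the sub, hence factors through the
    quotient, hence vanishes. *)
Lemma left_perp_torsion F : is_torsion_class (left_perp F).
Proof.
have quo : closed_under_quotients (left_perp F).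
  move=> Y Z f pY fs M FM h i z; have [y <-] := fs i z.
  by have [g <-] := rep_hom_comp f h; exact: pY.
have iso V W : rep_iso V W -> left_perp F V -> left_perp F W.
  by case/rep_iso_surj => f fs pV; exact: quo pV fs.
split=> //.
- exists (fun V => indecomposable V /\ left_perp F V) => [V []//|V].
  split=> [pV|[k [G [HG /rep_iso_sym /iso]]]]; first exact: krull_schmidt.
  apply; elim: k G HG => [|k IHk] G HG.
    by rewrite big_ord0 => M FM h i x; rewrite [x]rep0_zero linear0.
  rewrite big_ord_recl; set W := bigop _ _ _.
  have {IHk} pW : left_perp F W by apply: IHk => j.
  have [_ {HG}] := HG ord0; move: (G ord0) => A pA M FM h i [x y].
  have [f fE] := dsum_inl A W; have [g gE] := dsum_inr A W.
  have [hf hfE] := rep_hom_comp f h; have [hg hgE] := rep_hom_comp g h.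
  have -> : ((x, y) : dsum A W i) = f i x + g i y.
    by rewrite fE gE; congr (_, _); rewrite /= ?addr0 ?add0r.
  have := hfE i x; have := hgE i y; rewrite (pA M FM) (pW M FM) => e2 e1.
  by apply: etrans (linearD _ _ _) _; rewrite /= -e1 -e2 addr0.
move=> X Y Z pX pZ [U [UX UZ]] M FM h.
have {X pX UX} pU := iso _ _ (rep_iso_sym UX) pX.
have {Z pZ UZ} pQ := iso _ _ (rep_iso_sym UZ) pZ.
have hU i x : x \in U i -> h i x = 0.
  have [f fE] := subrep_incl U; have [hf hfE] := rep_hom_comp f h.
  by move=> xU; have := hfE i (vsproj (U i) x); rewrite fE vsprojK // pU.
have hpi i x : h i (vquot_repr (vquot_pi (U i) x)) = h i x.
  by apply/eqP; rewrite -subr_eq0 -linearB /= hU // -eq_vquot_pi vquot_piK.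
have [i k p q|a q|g gE] :=
  @rep_hom_ex _ _ (quot_rep U) M (fun i q => h i (vquot_repr q)).
- by rewrite -[p]vquot_piK -[q]vquot_piK -linearP !hpi linearP.
- by rewrite -[q]vquot_piK rep_map_quot !hpi rep_homP.
by move=> i x; rewrite -hpi -gE; exact: pQ.
Qed.

Section Closure.
Variable B : rep K Q -> Prop.
Hypothesis torB : is_torsion_class B.

Lemma torsion_quotient Y Z (f : rep_hom Y Z) : rep_surjective f -> B Y -> B Z.
Proof. by move=> fs BY; have [_ qB _] := torB; exact: qB BY fs. Qed.

Lemma torsion_zero V : ~ rep_nonzero V -> B V.
Proof.
move=> V0; have [[S HS E] _ _] := torB; apply/E; exists 0%N, (fun=> rep0 K Q).
split=> [[]//|]; rewrite big_ord0.
exact: rep_iso_trans (dsum_rep0 _) (rep_iso_sym (dsum_zerol _ V0)).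
Qed.

(** The image U of f is in B, being a quotient of X. *)
Lemma torsion_exact X Y (f : rep_hom X Y) (U : subrep Y) :
  (forall i y, y \in U i -> exists x, f i x = y) ->
  (forall i x, f i x \in U i) ->
  B X -> B (quot_rep U) -> B Y.
Proof.
move=> fs fU BX BQ; have [_ _ eB] := torB.
apply: (eB (rep_of_subrep U) Y (quot_rep U)) => //; last first.
  by exists U; split; exact: rep_iso_refl.
have [i k x y|a x|g gE] :=
  @rep_hom_ex _ _ X (rep_of_subrep U) (fun i x => vsproj (U i) (f i x)).
- by rewrite !linearP.
- apply: val_inj; rewrite [LHS]rep_of_subrepE /=.
  by rewrite !vsprojK ?rep_homP ?fU.
apply: (torsion_quotient (f := g)) BX => i y.
by have [x e] := fs i _ (subvsP y); exists x; rewrite gE e vsvalK.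
Qed.

Lemma image_subrep X Y (f : rep_hom X Y) :
  exists U : subrep Y, forall i y, y \in U i <-> exists x, f i x = y.
Proof.
have H i y : y \in limg (f i) <-> exists x, f i x = y.
  by split=> [/memv_imgP[x _ ->]|[x <-]]; [exists x|rewrite memv_img ?memvf].
have st a y :
    y \in limg (f (source a)) -> rep_map Y a y \in limg (f (target a)).
  by case/H => x <-; rewrite rep_homP memv_img ?memvf.
by exists (@Subrep _ _ Y (fun i => limg (f i)) st).
Qed.

(** The quotient of Y by the image of f is a quotient of Z, because that image
    contains the kernel of g. *)
Lemma torsion_extension X Y Z (f : rep_hom X Y) (g : rep_hom Y Z) :
  rep_surjective g -> (forall i y, g i y = 0 -> exists x, f i x = y) ->
  B X -> B Z -> B Y.
Proof.
move=> gs kg BX BZ; have [U UE] := image_subrep f.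
apply: (torsion_exact (f := f) (U := U)) BX _ => [i y /UE//|i x|].
  by apply/UE; exists x.
have gK i z : g i ((g i)^-1%VF z) = z.
  by apply: limg_lfunVK; have [y <-] := gs i z; rewrite memv_img ?memvf.
have [i k x y|a z|h hE] := @rep_hom_ex _ _ Z (quot_rep U)
    (fun i z => vquot_pi (U i) ((g i)^-1%VF z)).
- by rewrite !linearP.
- rewrite rep_map_quot; apply/eqP; rewrite eq_vquot_pi; apply/UE/kg.
  by rewrite linearB /= -rep_homP !gK subrr.
apply: (torsion_quotient (f := h)) BZ => i q; exists (g i (vquot_repr q)).
rewrite hE -[RHS]vquot_piK; apply/eqP; rewrite eq_vquot_pi; apply/UE/kg.
by rewrite linearB /= gK subrr.
Qed.

End Closure.
End Torsion.

(** * The linear quiver and its interval representations *)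

Section Chain.
Local Open Scope ring_scope.
Variable n : nat.
Local Notation A := (quiverA n).
Implicit Types (i j : vertex A) (a b : arrow A).

Definition pos i : nat := nat_of_ord (i : 'I_n).

Lemma pos_inj : injective pos. Proof. exact: val_inj. Qed.

Lemma pos_lt i : (pos i < n)%N. Proof. exact: (ltn_ord (i : 'I_n)). Qed.

Lemma vertex_at m : (m < n)%N -> exists i, pos i = m.
Proof. by move=> lt; exists (Ordinal lt). Qed.

Lemma pos_target a : pos (target a) = (pos (source a)).+1.
Proof. by case: a => p H; exact: (eqP H). Qed.

Lemma arrow_to m : (m.+1 < n)%N -> exists a, pos (source a) = m.
Proof.
move=> lt; pose p := (Ordinal (ltnW lt), Ordinal lt).
have H : (p.2 == p.1.+1 :> nat)%N by [].
by exists (exist _ p H).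
Qed.

Lemma source_inj a b : pos (source a) = pos (source b) -> a = b.
Proof.
case: a b => [[i j] /= H] [[i' j'] /= H'] /val_inj /= e; subst i'.
by apply: val_inj; congr (_, _); apply: val_inj; rewrite /= (eqP H) (eqP H').
Qed.

Lemma arrow_ind (P : vertex A -> Prop) c d :
  (forall i, pos i = c -> P i) ->
  (forall a, (c <= pos (source a))%N -> (pos (target a) <= d)%N ->
    P (source a) -> P (target a)) ->
  forall i, (c <= pos i <= d)%N -> P i.
Proof.
move=> Pc Pa i; have [m] := ubnP (pos i).
elim: m i => // m IHm i ltm /andP[ci id].
have [/Pc //|lt] : pos i = c \/ (c < pos i)%N by lia.
have [|a sa] := @arrow_to (pos i).-1; first by have := pos_lt i; lia.
have ta : target a = i by apply: pos_inj; rewrite pos_target sa; lia.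
by rewrite -ta; apply: Pa; [lia|rewrite ta|apply: IHm; lia].
Qed.

(** Recursion along the quiver for a family of types that depends on the vertex.
    Used to follow a vector of V_e through the maps of V; [chain_down] is the
    mirror image, used for the composite maps V_i -> V_d. *)
Lemma chain_up (T : vertex A -> Type)
    (s : forall a, T (source a) -> T (target a)) (t0 : forall i, T i) (e : nat) :
  exists x : forall i, T i, (forall i, (pos i <= e)%N -> x i = t0 i) /\
    forall a, (e <= pos (source a))%N -> x (target a) = s a (x (source a)).
Proof.
suff main k : exists x : forall i, T i,
    (forall i, (pos i <= e)%N -> x i = t0 i) /\
    forall a, (e <= pos (source a) < e + k)%N -> x (target a) = s a (x (source a)).
  have [x [x0 xs]] := main n.
  by exists x; split=> // a le; apply: xs; have := pos_lt (source a); lia.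
elim: k => [|k [x [x0 xs]]]; first by exists t0; split=> // a; lia.
have [[a0 sa0]|no] := classic (exists a0, pos (source a0) = (e + k)%N);
  last first.
  exists x; split=> // a le; apply: xs.
  have : pos (source a) <> (e + k)%N by move=> h; apply: no; exists a.
  by lia.
exists (dfwith x (s a0 (x (source a0)))); split=> [i le|a le].
  rewrite dfwith_out ?x0 //; apply/eqP => h.
  by have := pos_target a0; rewrite h; lia.
rewrite [in RHS]dfwith_out; last first.
  by apply/eqP => h; have := pos_target a0; rewrite h; lia.
have [/source_inj ->|ne] := eqVneq (pos (source a)) (pos (source a0)).
  by rewrite dfwith_in.
rewrite dfwith_out ?xs //; first by lia.
by apply/eqP => h; have := pos_target a0; rewrite h pos_target; lia.
Qed.

Lemma chain_down (T : vertex A -> Type)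
    (s : forall a, T (target a) -> T (source a)) (t0 : forall i, T i) (d : nat) :
  exists x : forall i, T i, (forall i, (d <= pos i)%N -> x i = t0 i) /\
    forall a, (pos (target a) <= d)%N -> x (source a) = s a (x (target a)).
Proof.
suff main k : exists x : forall i, T i,
    (forall i, (d <= pos i)%N -> x i = t0 i) /\
    forall a, (d <= pos (source a) + k)%N -> (pos (target a) <= d)%N ->
      x (source a) = s a (x (target a)).
  have [x [x0 xs]] := main d.
  by exists x; split=> // a le; apply: xs => //; lia.
elim: k => [|k [x [x0 xs]]].
  by exists t0; split=> // a; have := pos_target a; lia.
have [[a0 [sa0 ta0]]|no] := classic (exists a0,
    (pos (source a0) + k.+1)%N = d /\ (pos (target a0) <= d)%N); last first.
  exists x; split=> // a le le2; apply: xs => //.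
  have : (pos (source a) + k.+1)%N <> d by move=> h; apply: no; exists a.
  by lia.
exists (dfwith x (s a0 (x (target a0)))); split=> [i le|a le le2].
  rewrite dfwith_out ?x0 //; apply/eqP => h.
  by have := pos_target a0; rewrite h; lia.
rewrite [in RHS]dfwith_out; last first.
  by apply/eqP => h; have := pos_target a; rewrite -h; lia.
have [/source_inj ->|ne] := eqVneq (pos (source a)) (pos (source a0)).
  by rewrite dfwith_in.
rewrite dfwith_out ?xs //; first by lia.
by apply/eqP => h; move: ne; rewrite h eqxx.
Qed.

End Chain.

Section Interval.
Local Open Scope ring_scope.
Variables (K : fieldType) (n : nat).
Local Notation A := (quiverA n).
Implicit Types (i j : vertex A).

(** For p, q <= 1 this is the identity if p = q = 1, and 0 otherwise. *)
Definition spread p q (u : 'rV[K]_p) : 'rV[K]_q := const_mx (\sum_j u 0 j).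

Fact spread_is_linear p q : linear (@spread p q).
Proof.
move=> k u v; apply/rowP => j; rewrite !mxE mulr_sumr -big_split /=.
by apply: eq_bigr => l _; rewrite !mxE.
Qed.

HB.instance Definition _ p q :=
  GRing.isLinear.Build K _ _ _ (@spread p q) (@spread_is_linear p q).

(** The space at i is made of row vectors of length 1 or 0, according to whether i
    lies in [c, d]; [icoef] below is its injective coordinate, which is used for
    all computations. *)
Definition interval_rep (c d : nat) : rep K A :=
  @Rep K A (fun i => 'rV[K]_(c <= pos i <= d)%N)
    (fun a => linfun (@spread _ _)).

Definition icoef c d i (x : interval_rep c d i) : K :=
  \sum_j (x : 'rV[K]_(c <= pos i <= d)%N) 0 j.

Definition igen c d i (k : K) : interval_rep c d i :=
  (const_mx k : 'rV[K]_(c <= pos i <= d)%N).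

Lemma icoef_linear c d i (k : K) (x y : interval_rep c d i) :
  icoef (k *: x + y) = k * icoef x + icoef y.
Proof.
rewrite /icoef mulr_sumr -big_split /=; apply: eq_bigr => j _.
by rewrite !mxE.
Qed.

Lemma icoef0 c d i : icoef (0 : interval_rep c d i) = 0.
Proof. by rewrite /icoef big1 // => j _; rewrite mxE. Qed.

Lemma icoefZ c d i (k : K) (x : interval_rep c d i) :
  icoef (k *: x) = k * icoef x.
Proof. by rewrite -[k *: x]addr0 icoef_linear icoef0 addr0. Qed.

Lemma icoef_out c d i (x : interval_rep c d i) :
  ~~ (c <= pos i <= d)%N -> icoef x = 0.
Proof.
move=> out; rewrite /icoef big1 // => -[j ltj]; exfalso.
by move: ltj; rewrite (negbTE out).
Qed.

Lemma sum_const_rV (b : bool) (k : K) :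
  \sum_j (const_mx k : 'rV[K]_b) 0 j = if b then k else 0.
Proof.
by under eq_bigr do rewrite mxE; rewrite sumr_const card_ord; case: b.
Qed.

Lemma icoef_gen c d i k :
  icoef (igen c d i k) = if (c <= pos i <= d)%N then k else 0.
Proof. exact: sum_const_rV. Qed.

Lemma icoef_map c d a (x : interval_rep c d (source a)) :
  icoef (rep_map (interval_rep c d) a x) =
  if (c <= pos (target a) <= d)%N then icoef x else 0.
Proof. by rewrite /rep_map /= lfunE; exact: sum_const_rV. Qed.

Lemma icoef_inj c d i : injective (@icoef c d i).
Proof.
rewrite /icoef /interval_rep /=; case: (c <= pos i <= d)%N => x y /=.
  by rewrite !big_ord1 => e; apply/rowP => j; rewrite ord1.
by move=> _; rewrite [x]thinmx0 [y]thinmx0.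
Qed.

Section Homs.
Variable V : rep K A.

(** Since a map out of M[c,d] is given by the image of the generator at c, its
    images x further along are obtained by applying V. *)
Lemma hom_from_interval c d (x : forall i, V i) :
  (forall a, (c <= pos (source a) <= d)%N -> rep_map V a (x (source a)) =
     if (pos (target a) <= d)%N then x (target a) else 0) ->
  exists f : rep_hom (interval_rep c d) V, forall i u, f i u = icoef u *: x i.
Proof.
move=> H; apply: (@rep_hom_ex _ _ (interval_rep c d) V
  (fun i u => icoef u *: x i)) => [i k u v|a u].
  by rewrite icoef_linear scalerDl scalerA.
have -> : rep_map V a (icoef u *: x _) = icoef u *: rep_map V a (x _).
  by rewrite linearZ.
rewrite icoef_map; case: (boolP (c <= pos (source a) <= d)%N) => [ins|out].
  rewrite (H a ins); have := pos_target a; case: leqP => [le|gt] e.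
    by rewrite ifT //; lia.
  by rewrite ifF ?scaler0 ?scale0r //; lia.
by rewrite (icoef_out _ out) if_same !scale0r.
Qed.

(** Dually, a map to M[c,d] is given by a functional on V_d that kills the image
    of V_(c-1); phi lists its composites with the maps V_i -> V_d. *)
Lemma hom_to_interval c d (phi : forall i, V i -> K^o) :
  (forall i, linear (phi i)) ->
  (forall a x, (c <= pos (target a) <= d)%N -> phi (target a) (rep_map V a x) =
     if (c <= pos (source a))%N then phi (source a) x else 0) ->
  exists f : rep_hom V (interval_rep c d), forall i x,
    icoef (f i x) = if (c <= pos i <= d)%N then phi i x else 0.
Proof.
move=> L H; have [i k x y|a x|f fE] :=
  @rep_hom_ex _ _ V (interval_rep c d) (fun i x => igen c d i (phi i x)).
- apply: icoef_inj; rewrite icoef_linear !icoef_gen L.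
  by case: ifP; rewrite // mulr0 addr0.
- apply: icoef_inj; rewrite icoef_map !icoef_gen; case: ifP => // ins.
  rewrite H //.
  have -> // : (c <= pos (source a) <= d)%N = (c <= pos (source a))%N.
  by have := pos_target a; lia.
by exists f => i x; rewrite fE icoef_gen.
Qed.

End Homs.

(** This contains both the projections (c = a) and the inclusions (d = b). *)
Lemma interval_hom a b c d : (c <= a)%N -> (a <= d)%N -> (d <= b)%N ->
  exists f : rep_hom (interval_rep a b) (interval_rep c d), forall i x,
    icoef (f i x) = if (c <= pos i <= d)%N then icoef x else 0.
Proof.
move=> ca ad db.
apply: (@hom_to_interval (interval_rep a b) c d (@icoef a b))
  => [i k x y|al x ins].
  exact: icoef_linear.
rewrite icoef_map; have := pos_target al => e.
case: ifPn => [in2|out]; case: leqP => [le|gt] //.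
- by rewrite icoef_out //; lia.
- by rewrite icoef_out //; lia.
Qed.

End Interval.

(** * Torsion classes of the linear quiver *)

Section Main.
Local Open Scope ring_scope.
Variables (K : fieldType) (n : nat).
Local Notation A := (quiverA n).
Local Notation interval_rep := (@interval_rep K n).
Implicit Types (i j : vertex A) (V : rep K A).

Lemma interval_rep_outside c d i (x : interval_rep c d i) :
  ~~ (c <= pos i <= d)%N -> x = 0.
Proof. by move=> out; apply: icoef_inj; rewrite icoef0 icoef_out. Qed.

(** Take e to be the first vertex where f is nonzero; the image of f is M[e,d]. *)
Lemma hom_to_interval_image V c d (f : rep_hom V (interval_rep c d)) i x :
  f i x != 0 ->
  exists e, [/\ (c <= e)%N, (e <= d)%N &
    exists g : rep_hom V (interval_rep e d), rep_surjective g].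
Proof.
move=> nz; have Pi : [pred j | limg (f j) != 0%VS] i.
  by apply: contra nz => /eqP e; rewrite -memv0 -e memv_img ?memvf.
case: (arg_minnP (@pos n) Pi) => e0 /= ne0 min.
have zero j y : (pos j < pos e0)%N -> f j y = 0.
  move=> lt; apply/eqP; rewrite -memv0.
  have [<-|ne] := eqVneq (limg (f j)) 0%VS.
    by rewrite memv_img ?memvf.
  by have := min j ne; lia.
have [y ny] : exists y, icoef (f e0 y) != 0.
  apply: NNPP => h; case/negP: ne0; rewrite -subv0.
  apply/subvP => _ /memv_imgP[y _ ->].
  rewrite memv0; apply/negPn/negP => ny; apply: h; exists y.
  by apply: contra_neq ny => e; apply: icoef_inj; rewrite e icoef0.
have /andP[ce ed] : (c <= pos e0 <= d)%N.
  by apply: contraNT ny => /icoef_out ->.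
exists (pos e0); split=> //.
have [j k u v|a u ins|g gE] :=
    @hom_to_interval _ _ V (pos e0) d (fun j u => icoef (f j u)).
- by rewrite linearP icoef_linear.
- rewrite -rep_homP icoef_map ifT; last by lia.
  by case: leqP => // /zero ->; rewrite icoef0.
exists g => j z; have [ins|out] := boolP (pos e0 <= pos j <= d)%N; last first.
  by exists 0; rewrite linear0 [z]interval_rep_outside.
have [u nu] : exists u, icoef (f j u) != 0.
  apply: (@arrow_ind n (fun j => exists u, icoef (f j u) != 0) (pos e0) d) ins
    => [l /pos_inj ->|a le le2 [u nu]].
    by exists y.
  exists (rep_map V a u); rewrite -rep_homP icoef_map ifT //.
  by have := pos_target a; lia.
exists ((icoef z / icoef (f j u)) *: u); apply: icoef_inj.
by rewrite gE ins linearZ icoefZ divfK.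
Qed.

(** If a < e, the generator of M[a,b] at e comes from the vertex e - 1, where
    M[e,d] is zero, so it is killed. *)
Lemma interval_quotient a b e d
    (g : rep_hom (interval_rep a b) (interval_rep e d)) :
  (e <= d)%N -> (d < n)%N -> rep_surjective g -> a = e /\ (d <= b)%N.
Proof.
move=> ed dn gs.
have inside i : (e <= pos i <= d)%N -> (a <= pos i <= b)%N.
  move=> ins; apply: contraT => out; have [x e1] := gs i (igen e d i 1).
  have /eqP := congr1 (@icoef K n e d i) e1.
  rewrite icoef_gen ins (interval_rep_outside x out) linear0 icoef0 eq_sym.
  by rewrite oner_eq0.
have [i0 pi0] := vertex_at (leq_ltn_trans ed dn).
have [i1 pi1] := vertex_at dn.
have := inside i0; have := inside i1; rewrite pi0 pi1 => h1 h2.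
split; last by lia.
have [//|lt] : a = e \/ (a < e)%N by lia.
have [|al sal] := @arrow_to n e.-1; first by lia.
have tal := pos_target al; rewrite sal prednK in tal; last by lia.
have [x e1] := gs (target al) (igen e d _ 1).
have ex : x = rep_map (interval_rep a b) al (igen a b _ (icoef x)).
  apply: icoef_inj; rewrite icoef_map icoef_gen sal tal.
  by rewrite !ifT //; lia.
have gx : g (target al) x = 0.
  rewrite ex -rep_homP (interval_rep_outside (g (source al) _)) ?linear0 //.
  by rewrite sal; lia.
have /eqP := congr1 (@icoef K n e d _) e1.
by rewrite gx icoef_gen tal leqnn ed icoef0 eq_sym oner_eq0.
Qed.

(** S tells which intervals a torsion class contains; M[c,d] is forbidden if S
    holds for none of its subrepresentations M[e,d], the possible nonzero images
    of objects of the class. *)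
Definition forbidden (S : nat -> nat -> Prop) (M : rep K A) : Prop :=
  exists c d, [/\ (c <= d)%N, (d < n)%N,
    forall e, (c <= e)%N -> (e <= d)%N -> ~ S e d & M = interval_rep c d].

Definition torsion_of S := left_perp (forbidden S).

(** Closure of S under the quotients M[a,b] -> M[a,b'] and under the extensions
    of M[a,b] by M[b+1,c]. *)
Definition closed_intervals (S : nat -> nat -> Prop) : Prop :=
  (forall a b b', (a <= b')%N -> (b' <= b)%N -> (b < n)%N ->
    S a b -> S a b') /\
  (forall a b c, (a <= b)%N -> (b < c)%N -> (c < n)%N ->
    S a b -> S b.+1 c -> S a c).

(** If M[a,b] has no map to a forbidden interval, none of its quotients M[a,d] is
    forbidden, so S e d for some e with a <= e <= d; by induction on d,
    S a (e - 1) and S e d give S a d.  Conversely, the image of a nonzero map from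
    M[a,b] to M[c,d] is M[a,d] with c <= a, and S a d follows from S a b, so
    M[c,d] is not forbidden. *)
Lemma torsion_of_interval S a b :
  closed_intervals S -> (a <= b)%N -> (b < n)%N ->
  torsion_of S (interval_rep a b) <-> S a b.
Proof.
case=> Sq Se ab bn; split=> [pS|Sab].
  have ex d : (a <= d <= b)%N -> exists e, [/\ (a <= e)%N, (e <= d)%N & S e d].
    case/andP=> ad db; apply: NNPP => no.
    have [f fE] := interval_hom K n (leqnn a) ad db.
    have [i pi] := vertex_at (leq_ltn_trans db bn).
    have : icoef (f i (igen a b i 1)) = 0.
      rewrite (pS (interval_rep a d)) ?icoef0 //; exists a, d; split=> //.
        exact: leq_ltn_trans db bn.
      by move=> e ae ed Sed; apply: no; exists e.
    by rewrite fE icoef_gen pi ad db leqnn /= => /eqP; rewrite oner_eq0.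
  have main d : (a <= d <= b)%N -> S a d.
    elim: d => [|d IHd] ins.
      by have [e [ae ed]] := ex _ ins; have -> : e = a by lia.
    have [e [ae ed Sed]] := ex _ ins.
    have [->//|lt] : a = e \/ (a < e)%N by lia.
    apply: (Se _ e.-1) => //; try lia; last by rewrite prednK //; lia.
    by apply: (Sq _ d); try lia; apply: IHd; lia.
  by apply: main; rewrite ab leqnn.
move=> M [c [d [cd dn no ->]]] f i x; apply/eqP/negPn/negP => nz.
have [e [ce ed [g gs]]] := hom_to_interval_image nz.
have [ae db] := interval_quotient ed dn gs; subst e.
exact: (no a ce ed (Sq _ _ _ ed db bn Sab)).
Qed.

Section TorsionClass.
Variable B : rep K A -> Prop.
Hypothesis torB : is_torsion_class B.

Lemma torsion_closed_intervals :
  closed_intervals (fun a b => B (interval_rep a b)).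
Proof.
split=> [a b b' ab bb bn|a b c ab bc cn Bab Bbc].
  have [f fE] := interval_hom K n (leqnn a) ab bb.
  apply: (torsion_quotient torB (f := f)) => i y.
  exists (igen a b i (icoef y)); apply: icoef_inj; rewrite fE icoef_gen.
  have [ins|out] := boolP (a <= pos i <= b')%N; last by rewrite icoef_out.
  by rewrite ifT //; lia.
have [f fE] := interval_hom K n (leqW ab) bc (leqnn c).
have [g gE] := interval_hom K n (leqnn a) ab (ltnW bc).
apply: (torsion_extension torB (f := f) (g := g)) => // [i y|i y gy].
  exists (igen a c i (icoef y)); apply: icoef_inj; rewrite gE icoef_gen.
  have [ins|out] := boolP (a <= pos i <= b)%N; last by rewrite icoef_out.
  by rewrite ifT //; lia.
exists (igen b.+1 c i (icoef y)); apply: icoef_inj; rewrite fE icoef_gen.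
case: ifPn => [ins|out]; last by rewrite icoef_out.
case: ifPn => // out; have := congr1 (@icoef K n a b i) gy.
by rewrite gE icoef0 ifT //; lia.
Qed.

Lemma functional_sep (vT : vectType K) (R : {vspace vT}) : R != fullv ->
  exists psi : vT -> K^o,
    [/\ linear psi, forall x, x \in R -> psi x = 0 & exists y, psi y != 0].
Proof.
move=> nR.
have [y ny] : exists y, y \notin R.
  apply: NNPP => h; case/negP: nR; rewrite eqEsubv subvf; apply/subvP => y _.
  by apply/negPn/negP => ny; apply: h; exists y.
pose X := vbasis {: vquot R}.
have nz : vquot_pi R y != 0.
  by rewrite -(linear0 (@vquot_pi _ _ R)) eq_vquot_pi subr0.
have /existsP[j nj] : [exists j, coord X j (vquot_pi R y) != 0].
  rewrite -negb_forall; apply: contra nz => /forallP z.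
  rewrite (coord_vbasis (memvf (vquot_pi R y))) big1 // => j _.
  by rewrite (eqP (z j)) scale0r.
exists (fun x => coord X j (vquot_pi R x)); split; last by exists y.
  by move=> k u v; rewrite !linearP.
move=> x xR; have -> : vquot_pi R x = 0.
  by apply/eqP; rewrite -(linear0 (@vquot_pi _ _ R)) eq_vquot_pi subr0.
by rewrite linear0.
Qed.

(** Induction on the dimension: V is split off along the image of a nonzero map
    M[e,d] -> V from an interval in B, where d is the last vertex of the support
    of V.  Such an e exists because otherwise V would map to a forbidden
    interval.  In the proof [g] is the family of composite maps V_i -> V_d. *)
Lemma torsion_of_torsion V :
  B V <-> torsion_of (fun a b => B (interval_rep a b)) V.
Proof.
split=> [BV _ [c [d [cd dn no ->]]] f i x|].
  apply/eqP/negPn/negP => nz.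
  have [e [ce ed [g gs]]] := hom_to_interval_image nz.
  exact: no e ce ed (torsion_quotient torB gs BV).
have [m] := ubnP (rep_dim V); elim: m V => // m IHm V ltm pV.
have [nzV|/torsion_zero] := classic (rep_nonzero V); last exact.
have [d [nd zd]] : exists d, \dim {: V d} != 0%N /\
    forall i, (pos d < pos i)%N -> forall x : V i, x = 0.
  case: nzV => i [x nx].
  have Pi : [pred j | \dim {: V j} != 0%N] i.
    by rewrite /= dimv_eq0; apply: contra nx => /eqP e; rewrite -memv0 -e memvf.
  case: (arg_maxnP (@pos n) Pi) => d /= nd max; exists d; split=> // j lt y.
  apply/eqP; rewrite -memv0; have [/eqP|ne] := eqVneq (\dim {: V j}) 0%N.
    by rewrite dimv_eq0 => /eqP <-; rewrite memvf.
  by have := max j ne; lia.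
have nzd : fullv != 0%VS :> {vspace V d} by rewrite -dimv_eq0.
have [g [g0 gs]] := @chain_down n (fun i => 'Hom(V i, V d))
  (fun a f => (f \o rep_map V a)%VF)
  (dfwith (fun i => 0 : 'Hom(V i, V d)) (\1%VF : 'Hom(V d, V d))) (pos d).
have gd x : g d x = x by rewrite g0 // dfwith_in id_lfunE.
have {}gs a x : (pos (target a) <= pos d)%N ->
    g (source a) x = g (target a) (rep_map V a x).
  by move=> le; rewrite (gs a le) comp_lfunE.
have Pd : [pred j | (pos j <= pos d)%N && (limg (g j) == fullv)] d.
  rewrite /= leqnn /= eqEsubv subvf; apply/subvP => x _.
  by rewrite -[x]gd memv_img ?memvf.
case: (arg_minnP (@pos n) Pd) => c /= /andP[cd /eqP fullc] min.
have [e [/andP[ce ed] Be]] :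
    exists e, (pos c <= e <= pos d)%N /\ B (interval_rep e (pos d)).
  apply: NNPP => no.
  (* [R] is the image of the vertex before [c], or 0 if [c] is the first one *)
  have [R [nR HR]] : exists R : {vspace V d}, R != fullv /\
      forall a x, target a = c -> g (source a) x \in R.
    have [[a ta]|noa] := classic (exists a, target a = c); last first.
      by exists 0%VS; split=> [|a x ta]; [rewrite eq_sym|case: noa; exists a].
    have sa := pos_target a; rewrite ta in sa.
    exists (limg (g (source a))); split=> [|b x tb].
      by apply/negP => full; have := min (source a); rewrite full andbT; lia.
    have eb : b = a by apply: source_inj; have := pos_target b; rewrite tb; lia.
    subst b.
    by rewrite memv_img ?memvf.
  have [psi [psil psiR [y ny]]] := functional_sep nR.
  have [i k u v|a u ins|f fE] :=
      @hom_to_interval _ _ V (pos c) (pos d) (fun i u => psi (g i u)).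
  - by rewrite linearP psil.
  - rewrite -gs; last by lia.
    case: leqP => // lt; apply/psiR/HR/pos_inj.
    by have := pos_target a; lia.
  case/negP: ny; have := fE d y; rewrite gd cd leqnn /= => <-.
  rewrite (pV (interval_rep (pos c) (pos d))) ?icoef0 //.
  exists (pos c), (pos d); split=> //.
  by move=> e ce ed Be; apply: no; exists e; rewrite ce ed.
have [e0 pe0] : exists e0 : vertex A, pos e0 = e.
  by apply: vertex_at; have := pos_lt d; lia.
rewrite -{}pe0 in ce ed Be.
have fulle : limg (g e0) = fullv.
  have ins : (pos c <= pos e0 <= pos d)%N by rewrite ce ed.
  apply: (arrow_ind (P := fun i => limg (g i) = fullv)) ins
    => [l /pos_inj -> //|a le le2 full].
  apply/eqP; rewrite eqEsubv subvf -full; apply/subvP => _ /memv_imgP[x _ ->].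
  by rewrite gs // memv_img ?memvf.
have [x nx] : exists x : V e0, x != 0.
  apply: NNPP => no; case/negP: nzd; rewrite -fulle -subv0.
  apply/subvP => _ /memv_imgP[x _ ->].
  have [-> |nx] := eqVneq x 0; first by rewrite linear0 mem0v.
  by case: no; exists x.
have [xs [xs0 xss]] := @chain_up n (fun i => V i) (fun a => rep_map V a)
  (dfwith (fun i => 0 : V i) x) (pos e0).
have xse : xs e0 = x by rewrite xs0 // dfwith_in.
have [a /andP[le le2]|f fE] := @hom_from_interval _ _ V (pos e0) (pos d) xs.
  by rewrite -xss //; case: leqP => // lt; rewrite [LHS]zd.
have [U UE] := image_subrep f.
apply: (torsion_exact torB (f := f) (U := U)) Be _ => [i y /UE //|i u|].
  by apply/UE; exists u.
have [p ps pE] := quot_proj U.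
have Ux : x \in U e0.
  by apply/UE; exists (igen _ _ e0 1); rewrite fE icoef_gen leqnn ed /= scale1r.
apply: IHm.
  by apply: (leq_trans (rep_dim_lt ps _ nx) ltm); apply/eqP; rewrite pE.
have [_ qB _] :=
  @left_perp_torsion K A (forbidden (fun a b => B (interval_rep a b))).
exact: qB pV ps.
Qed.

End TorsionClass.
End Main.

(** * Trees and torsion classes *)

(** The entry at a counts the b with S a b; closure under quotients makes these b
    an initial segment of a, a + 1, ..., and closure under extensions is the
    nestedness of the ranges. *)
Lemma closed_intervals_vector n (S : nat -> nat -> Prop) :
  closed_intervals n S ->
  exists w, [/\ size w = n.+1, bracket_vector w &
    forall a b, a <= b -> b < n -> S a b <-> b < a + nth 0 w a].
Proof.
case=> Sq Se.
have row (a : 'I_n.+1) : exists l, a + l <= n /\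
    forall b, a <= b -> b < n -> S a b <-> b < a + l.
  have [l [ln all_l nS]] : exists l, [/\ a + l <= n,
      forall b, a <= b -> b < a + l -> S a b & a + l < n -> ~ S a (a + l)].
    suff main k : a + k <= n -> exists l, [/\ l <= k,
        forall b, a <= b -> b < a + l -> S a b & l < k -> ~ S a (a + l)].
      have [|l [ln all_l nS]] := main (n - a); first by have := ltn_ord a; lia.
      by exists l; split=> // [|lt]; [have := ltn_ord a; lia|apply: nS; lia].
    elim: k => [|k IHk] le; first by exists 0; split=> // b; lia.
    have [|l [lk all_l nS]] := IHk; first by lia.
    have [lt|ge] := ltnP l k.
      by exists l; split=> // [|_]; [lia|exact: nS].
    have [Sk|nSk] := classic (S a (a + l)); last by exists l; split=> //; lia.
    exists l.+1; split=> [|b ab bl|lt]; [by lia| |by lia].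
    have [->//|lt] : b = a + l \/ b < a + l by lia.
    exact: all_l.
  exists l; split=> // b ab bn; split=> [Sab|]; last exact: all_l.
  rewrite ltnNge; apply/negP => le; apply: nS; first by lia.
  by apply: (Sq a b) => //; exact: leq_addr.
have [l H] := fin_all_exists row.
pose w := mkseq (fun i => l (inord i)) n.+1.
have wn i : i <= n -> nth 0 w i = l (inord i) by move=> le; rewrite nth_mkseq.
have w_le i : i <= n -> i + nth 0 w i <= n.
  by move=> le; have [] := H (inord i); rewrite wn // inordK.
have wS a b : a <= b -> b < n -> S a b <-> b < a + nth 0 w a.
  move=> ab bn; have an : a <= n by lia.
  by have [_ /(_ b)] := H (inord a); rewrite wn // inordK //; exact.
exists w; split=> //; first exact: size_mkseq.
move=> i; rewrite size_mkseq ltnS => lin; split; first by rewrite ltnS w_le.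
move=> j ij jle; have jn : j <= n by apply: leq_trans (w_le i lin).
have := w_le j jn; have := w_le i lin => hi hj.
have [|pos_j] := posnP (nth 0 w j); first by lia.
suff : (j + nth 0 w j).-1 < i + nth 0 w i by lia.
apply/wS; try lia; apply: (Se i j.-1); try lia.
  by apply/wS; lia.
rewrite prednK; last by lia.
by apply/wS; lia.
Qed.

Section Final.
Variables (K : fieldType) (n : nat).
Implicit Types s t : tamari n.

Lemma size_bvec_tamari t : size (bvec (val t)) = n.+1.
Proof. by have /eqP := valP t; rewrite size_bvec => -[]. Qed.

Definition tree_intervals t (a b : nat) : Prop :=
  b < a + nth 0 (bvec (val t)) a.

Lemma tree_closed_intervals t : closed_intervals n (tree_intervals t).
Proof.
rewrite /tree_intervals; split=> [a b b' ab bb bn|a b c ab bc cn Sab Sbc].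
  exact: leq_ltn_trans.
have [|_ /(_ b.+1)] := @bvec_bracket_vector (val t) a; last by lia.
by rewrite size_bvec_tamari; lia.
Qed.

Definition tree_torsion t : torsion_class K (quiverA n) :=
  exist _ (torsion_of (tree_intervals t)) (left_perp_torsion _).

(** More intervals prescribed means fewer forbidden ones, hence a larger class;
    and the class determines the prescribed intervals. *)
Lemma tree_torsion_le s t :
  torsion_le (tree_torsion s) (tree_torsion t) <-> tamari_le s t.
Proof.
rewrite tamari_leP; split=> [le i|le V sV M [c [d [cd dn no ->]]]].
  have [lt|ge] := ltnP i (size (bvec (val s))); last by rewrite nth_default.
  have [] := bvec_bracket_vector lt; rewrite size_bvec_tamari => hi _.
  have [->//|pos_i] := posnP (nth 0 (bvec (val s)) i).
  pose b := (i + nth 0 (bvec (val s)) i).-1.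
  have ib : i <= b by rewrite /b; lia.
  have bn : b < n by rewrite /b; lia.
  have Ss : tree_intervals s i b by rewrite /tree_intervals /b; lia.
  have/(torsion_of_interval K (tree_closed_intervals s) ib bn) := Ss.
  move=> /le /(torsion_of_interval K (tree_closed_intervals t) ib bn).
  by rewrite /tree_intervals /b; lia.
apply: sV; exists c, d; split=> // e ce ed Sed; apply: (no e ce ed).
by apply: leq_trans Sed _; rewrite leq_add2l le.
Qed.

Lemma torsion_le_anti (B C : torsion_class K (quiverA n)) :
  torsion_le B C -> torsion_le C B -> B = C.
Proof.
case: B C => [B HB] [C HC] BC CB.
have e : B = C.
  apply: functional_extensionality => V; apply: propositional_extensionality.
  by split; [exact: BC|exact: CB].
by subst C; congr exist; exact: proof_irrelevance.
Qed.

Lemma tree_torsion_onto (B : torsion_class K (quiverA n)) :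
  exists t, tree_torsion t = B.
Proof.
case: B => B HB.
have [w [sw vw wS]] := closed_intervals_vector (torsion_closed_intervals HB).
have [t0 e] := bvec_onto vw.
have ht : letters t0 == n.+2 by rewrite size_bvec e sw.
pose t : tamari n := exist _ t0 ht; exists t.
have same a b : a <= b -> b < n ->
    B (interval_rep K n a b) <-> tree_intervals t a b.
  by move=> ab bn; rewrite wS // /tree_intervals /= e.
apply: torsion_le_anti => V /=.
  move=> tV; apply/(torsion_of_torsion HB) => M [c [d [cd dn no ->]]].
  apply: tV; exists c, d; split=> // i ci id /same Si.
  by apply: (no i ci id); exact: Si.
move=> /(torsion_of_torsion HB) BV M [c [d [cd dn no ->]]].
apply: BV; exists c, d; split=> // i ci id Si; apply: (no i ci id); exact/same.
Qed.

End Final.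

Theorem corollary10p2 (K : fieldType) (n : nat) (hn : (1 <= n)%N) :
  poset_isomorphic (@torsion_le K (quiverA n)) (@tamari_le n).
Proof.
have inj : injective (@tree_torsion K n).
  move=> s t e; apply: val_inj; apply: bvec_inj.
  have st : vle (bvec (val s)) (bvec (val t)).
    by apply/tamari_leP/(tree_torsion_le K); rewrite e.
  have ts : vle (bvec (val t)) (bvec (val s)).
    by apply/tamari_leP/(tree_torsion_le K); rewrite e.
  apply: (@eq_from_nth _ 0) => [|i _]; first by rewrite !size_bvec_tamari.
  by apply/eqP; rewrite eqn_leq st ts.
pose f B := proj1_sig
  (constructive_indefinite_description _ (@tree_torsion_onto K n B)).
have fK : cancel f (@tree_torsion K n).
  by move=> B; rewrite /f; case: constructive_indefinite_description.
exists f; first by exists (@tree_torsion K n) => // t; apply: inj; rewrite fK.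
by move=> B C; rewrite -(tree_torsion_le K) !fK.
Qed.
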